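(* Let $d\ge1$ and let $P\colon\mathbb Z^2\to\mathbb{RP}^{2d}$ be a generic Kœnigs $d$-grid. Let $\mathcal C$ be the unique instance of special touching conics of $P$, with touching point nets $S,T$, and let $\mathcal Q$ be the special inscribed quadric of $P$. Define $\sigma,\tau\colon\mathbb Z\to\mathbb{RP}^{2d}$ by $$\sigma(j):=S^{\mathrm h}(j)\cap S^{\mathrm h}(j+1)\cap\dots\cap S^{\mathrm h}(j+d-1),\qquad \tau(i):=T^{\mathrm v}(i)\cap T^{\mathrm v}(i+1)\cap\dots\cap T^{\mathrm v}(i+d-1).$$ Then the two curves $\sigma,\tau$ are (well-defined and form) a generic pair of autoconjugate curves of $\mathcal Q$.
   Context: Notation: $\Sigma_m=\{0,1,\dots,m\}$, $\Sigma_{a,b}=\Sigma_a\times\Sigma_b$; $\vee$ denotes join. For any map $F$ defined on a subset of $\mathbb Z^2$, $F^{\mathrm h}(j)$ is the join of all $F(i,j)$ with $j$ fixed, $F^{\mathrm v}(i)$ the join of all $F(i,j)$ with $i$ fixed. By convention $\emptyset$ has dimension $-1$. Q-nets: a Q-net is a map $P$ from $\mathbb Z^2$ (or $\Sigma_{a,b}$) to $\mathbb{RP}^n$ such that the four points of every face (unit square) lie in a plane. It is non-degenerate if the points at the two ends of each edge are distinct and any three of the four points of each face span a plane. A Q-net on $\Sigma_{a,b}$ is extensive if it is non-degenerate and the join of its image is $(a+b)$-dimensional; a Q-net is $\Sigma_{d,d}$-extensive if its restriction to every translate of $\Sigma_{d,d}$ in the domain is extensive. Laplace transforms: for a non-degenerate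 Q-net, $\mathcal L_+P(i,j)=(P(i,j)\vee P(i,j+1))\cap(P(i+1,j)\vee P(i+1,j+1))$ and $\mathcal L_-P(i,j)=(P(i,j)\vee P(i+1,j))\cap(P(i,j+1)\vee P(i+1,j+1))$; these are Q-nets. $P_m=(\mathcal L_+)^mP$, $P_{-m}=(\mathcal L_-)^mP$; $P_{\pm m}$ exists if all preceding iterates are non-degenerate. $P_m$ is nowhere Laplace degenerate if $P_m(i,j)\ne P_m(i+1,j)$ for all $i,j$; $P_{-m}$ is nowhere Laplace degenerate if $P_{-m}(i,j)\ne P_{-m}(i,j+1)$ for all $i,j$. Kœnigs nets: an inscribed conic of a face of a non-degenerate Q-net is a conic in the plane of the face which is either a non-degenerate conic tangent to the four edge-lines, or the double line $P_1(i,j)\vee P_{-1}(i,j)$ (touching each edge-line in its intersection point with it); no other degenerate conics are admitted. An instance of touching conics $\mathcal C$ assigns to each face, with vertices $P(i,j),P(i+1,j),P(i+1,j+1),P(i,j+1)$, an inscribed conic $\mathcal C(i,j)$ such that for every edge shared by two faces the two conics touch the edge-line in the same point. A Kœnigs net is a non-degenerate Q-net that admits an instance of touching conics. Touching points: $S(i,j)$ is the point where the conics of the faces adjacent to the edge $(i,j),(i+1,j)$ touch the line $P(i,j)\vee P(i+1,j)$; $T(i,j)$ is the point where the conics of the faces adjacent to the edge $(i,j),(i,j+1)$ touch the line $P(i,j)\vee P(i,j+1)$. Grids: $P$ is a $d$-grid if all $P^{\mathrm h}(j)$ and $P^{\mathrm v}(i)$ are $d$-dimensional. A $d$-grid is generic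 if it is $\Sigma_{d,d}$-extensive and $P_d$ and $P_{-d}$ exist and are nowhere Laplace degenerate. A generic Kœnigs $d$-grid is a Kœnigs net that is a generic $d$-grid. An instance of touching conics of a $\Sigma_{d,d}$-extensive Kœnigs $d$-grid in $\mathbb{RP}^{2d}$ is special if all $T^{\mathrm v}(i)$ and all $S^{\mathrm h}(j)$ are $(d-1)$-dimensional. Quadrics: a quadric is the zero set of a non-zero symmetric bilinear form; it is non-degenerate if it is non-empty and has no singular point. An inscribed quadric with respect to $\mathcal C$ is a quadric $\mathcal Q\subset\mathbb{RP}^{2d}$ with $\mathcal Q\cap(P(i,j)\vee P(i+1,j)\vee P(i,j+1))=\mathcal C(i,j)$ for all faces, and $T^{\mathrm v}(i)\subset\mathcal Q$, $S^{\mathrm h}(j)\subset\mathcal Q$ for all $i,j$. The special inscribed quadric is the unique inscribed quadric with respect to the special touching conics; it is non-degenerate. (Existence and uniqueness of the special touching conics and of the special inscribed quadric for generic Kœnigs $d$-grids are established separately and presupposed here.) Curves: for $\gamma\colon\mathbb Z\to\mathbb{RP}^n$ and $0\le k\le n$ the osculating space is $C_{(k)}(j)=\gamma(j)\vee\gamma(j+1)\vee\dots\vee\gamma(j+k)$, and $C_{(-1)}(j)=\emptyset$. A curve $\gamma\colon\mathbb Z\to\mathbb{RP}^{2d}$ is autoconjugate with respect to (of) $\mathcal Q$ if every $C_{(d-1)}(i)$ is contained in $\mathcal Q$. A pair $\sigma,\tau\colon\mathbb Z\to\mathbb{RP}^n$ with osculating spaces $S_{(k)}(j)$, $T_{(k)}(i)$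 respectively is generic if $\dim\big(S_{(k)}(j)\vee T_{(n-k-1)}(i)\big)=n$ for all $i,j\in\mathbb Z$ and all $-1\le k\le n$. *)

(* Defs.v *)
From HB Require Import structures.
From mathcomp Require Import all_boot all_order all_algebra.
From mathcomp Require Import boolp classical_sets reals.

Set Implicit Arguments.
Unset Strict Implicit.
Unset Printing Implicit Defensive.

Import Order.TTheory GRing.Theory Num.Theory.

Local Open Scope classical_set_scope.
Local Open Scope ring_scope.

(** Projective subspaces of RP^n are the linear subspaces of R^(n+1): a
    projective dimension k corresponds to [\dim U = k.+1], the empty subspace
    (dimension -1) is [0%VS], and a point is a subspace with [\dim p = 1%N].
    Nets and curves are maps into all projective subspaces; that their values
    are points is always part of the predicates below. *)
Notation psubspace R n := {vspace 'rV[R]_n.+1}.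

Local Notation "U \v W" := (addv U W) (at level 50, left associativity).
Local Notation "U \m W" := (capv U W) (at level 48, left associativity).

Section Projective.
Variables (R : realType) (n : nat).
Implicit Types (U W p : psubspace R n).

Definition points U : set (psubspace R n) :=
  [set p | \dim p = 1%N /\ (p <= U)%VS].

Definition is_bigjoin (I : Type) (F : I -> psubspace R n) U : Prop :=
  (forall i, (F i <= U)%VS) /\
  (forall W, (forall i, (F i <= W)%VS) -> (U <= W)%VS).

Definition bigjoin (I : Type) (F : I -> psubspace R n) : psubspace R n :=
  xget 0%VS [set U | is_bigjoin F U].

Lemma bigjoinP (I : Type) (F : I -> psubspace R n) : is_bigjoin F (bigjoin F).
Proof.
suff [U FU] : exists U, is_bigjoin F U by exact: (xgetPex 0%VS (ex_intro _ U FU)).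
pose Q k := `[< exists s : seq I, k = \dim (\sum_(i <- s) F i)%VS >].
have Q0 : exists k, Q k.
  by exists (\dim (\sum_(i <- [::]) F i)%VS); apply/asboolP; exists [::].
have Qle k : Q k -> (k <= \dim (fullv : psubspace R n))%N.
  by move=> /asboolP[s ->]; exact: dimvS (subvf _).
case: (ex_maxnP Q0 Qle) => m /asboolP[s ms] maxm.
exists (\sum_(i <- s) F i)%VS; split=> [i|W FW]; last first.
  by elim/big_ind: _ => // [|A B AW BW]; rewrite ?sub0v // subv_add AW BW.
have sU : (\sum_(j <- s) F j <= \sum_(j <- i :: s) F j)%VS.
  by rewrite big_cons addvSr.
have -> : (\sum_(j <- s) F j = \sum_(j <- i :: s) F j)%VS.
  apply/eqP; rewrite eqEdim sU /= -ms; apply: maxm.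
  by apply/asboolP; exists (i :: s).
by rewrite big_cons addvSl.
Qed.

(** Quadrics are sets of points. [zeros B U] is the zero set, within the
    subspace [U], of the form with matrix [B]; as every symmetric bilinear form
    on [U] extends to the whole space, taking [B] on the whole space is no
    restriction. *)
Definition bform (B : 'M[R]_n.+1) (u v : 'rV[R]_n.+1) : R :=
  (u *m B *m v^T) 0 0.

Definition zeros (B : 'M[R]_n.+1) U : set (psubspace R n) :=
  [set p | points U p /\ forall v, v \in p -> bform B v v = 0].

Definition singular_point (B : 'M[R]_n.+1) U p : Prop :=
  points U p /\ forall u v, u \in p -> v \in U -> bform B u v = 0.

Definition quadric_in U (Q : set (psubspace R n)) : Prop :=
  exists B : 'M[R]_n.+1,
    [/\ B^T = B,
        exists u v, [/\ u \in U, v \in U & bform B u v <> 0]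
      & Q = zeros B U].

Definition nondegenerate_quadric_in U (Q : set (psubspace R n)) : Prop :=
  exists B : 'M[R]_n.+1,
    [/\ B^T = B,
        exists u v, [/\ u \in U, v \in U & bform B u v <> 0],
        Q = zeros B U,
        Q !=set0
      & forall p, ~ singular_point B U p].

(** A line touches a non-degenerate conic in [p] iff [p] is their only common
    point; a double line touches a transversal line in their intersection. *)
Definition touches (X : set (psubspace R n)) (l p : psubspace R n) : Prop :=
  X `&` points l = [set p].

Definition tangent (X : set (psubspace R n)) (l : psubspace R n) : Prop :=
  exists p, touches X l p.

End Projective.

Section Nets.
Variables (R : realType) (n : nat).
Implicit Types (P F S T : int -> int -> psubspace R n) (D : int -> int -> Prop).
Implicit Types (C : int -> int -> set (psubspace R n)) (Q : set (psubspace R n)).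

Definition hjoin F (j : int) : psubspace R n := bigjoin (fun i : int => F i j).
Definition vjoin F (i : int) : psubspace R n := bigjoin (fun j : int => F i j).

Definition plane_domain : int -> int -> Prop := fun _ _ => True.
Definition Sigma (a b : nat) : int -> int -> Prop :=
  fun i j => (0 <= i <= a%:Z) /\ (0 <= j <= b%:Z).

Definition face_in D (i j : int) : Prop :=
  [/\ D i j, D (i + 1) j, D (i + 1) (j + 1) & D i (j + 1)].

Definition face P (i j : int) : psubspace R n :=
  P i j \v P (i + 1) j \v P (i + 1) (j + 1) \v P i (j + 1).

(** The values of [P] outside of the domain [D] are irrelevant. *)
Definition qnet_on D P : Prop :=
  (forall i j : int, D i j -> \dim (P i j) = 1%N) /\
  (forall i j : int, face_in D i j -> (\dim (face P i j) <= 3)%N).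

Definition nondegenerate_on D P : Prop :=
  [/\ qnet_on D P,
      forall i j : int, D i j -> D (i + 1) j -> P i j <> P (i + 1) j,
      forall i j : int, D i j -> D i (j + 1) -> P i j <> P i (j + 1)
    & forall i j : int, face_in D i j ->
      [/\ \dim (P (i + 1) j \v P (i + 1) (j + 1) \v P i (j + 1)) = 3%N,
          \dim (P i j \v P (i + 1) (j + 1) \v P i (j + 1)) = 3%N,
          \dim (P i j \v P (i + 1) j \v P i (j + 1)) = 3%N
        & \dim (P i j \v P (i + 1) j \v P (i + 1) (j + 1)) = 3%N]].

Definition qnet P : Prop := qnet_on plane_domain P.
Definition nondegenerate P : Prop := nondegenerate_on plane_domain P.

Definition extensive (a b : nat) P : Prop :=
  nondegenerate_on (Sigma a b) P /\
  \dim (\sum_(i < a.+1) \sum_(j < b.+1) P i%:Z j%:Z)%VS = (a + b).+1.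

Definition Sigma_extensive (d : nat) P : Prop :=
  forall i0 j0 : int, extensive d d (fun i j => P (i0 + i) (j0 + j)).

Definition laplace_plus P : int -> int -> psubspace R n := fun i j =>
  (P i j \v P i (j + 1)) \m (P (i + 1) j \v P (i + 1) (j + 1)).
Definition laplace_minus P : int -> int -> psubspace R n := fun i j =>
  (P i j \v P (i + 1) j) \m (P i (j + 1) \v P (i + 1) (j + 1)).

Definition P_plus (m : nat) P := iter m laplace_plus P.
Definition P_minus (m : nat) P := iter m laplace_minus P.

Definition P_plus_exists (m : nat) P : Prop :=
  forall k, (k < m)%N -> nondegenerate (P_plus k P).
Definition P_minus_exists (m : nat) P : Prop :=
  forall k, (k < m)%N -> nondegenerate (P_minus k P).

Definition P_plus_nowhere_laplace_degenerate (m : nat) P : Prop :=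
  forall i j : int, P_plus m P i j <> P_plus m P (i + 1) j.
Definition P_minus_nowhere_laplace_degenerate (m : nat) P : Prop :=
  forall i j : int, P_minus m P i j <> P_minus m P i (j + 1).

Definition hedge P (i j : int) : psubspace R n := P i j \v P (i + 1) j.
Definition vedge P (i j : int) : psubspace R n := P i j \v P i (j + 1).

(** As a set of points, the double line is just the line. *)
Definition inscribed_conic P (i j : int) (X : set (psubspace R n)) : Prop :=
  [/\ nondegenerate_quadric_in (face P i j) X,
      tangent X (hedge P i j), tangent X (hedge P i (j + 1)),
      tangent X (vedge P i j) & tangent X (vedge P (i + 1) j)]
  \/ X = points (laplace_plus P i j \v laplace_minus P i j).

(** [S] and [T] are the touching points of [C]. The edge (i,j),(i+1,j) is
    shared by the faces (i,j-1) and (i,j), the edge (i,j),(i,j+1) by the faces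
    (i-1,j) and (i,j). *)
Definition touching_points P C S T : Prop :=
  forall i j : int,
    [/\ touches (C i (j - 1)) (hedge P i j) (S i j),
        touches (C i j) (hedge P i j) (S i j),
        touches (C (i - 1) j) (vedge P i j) (T i j)
      & touches (C i j) (vedge P i j) (T i j)].

Definition touching_conics P C : Prop :=
  (forall i j : int, inscribed_conic P i j (C i j)) /\
  (exists S T, touching_points P C S T).

Definition koenigs_net P : Prop :=
  nondegenerate P /\ exists C, touching_conics P C.

Definition grid (d : nat) P : Prop :=
  [/\ qnet P, forall j, \dim (hjoin P j) = d.+1
    & forall i, \dim (vjoin P i) = d.+1].

Definition generic_grid (d : nat) P : Prop :=
  [/\ grid d P,
      Sigma_extensive d P,
      P_plus_exists d P /\ P_plus_nowhere_laplace_degenerate d P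
    & P_minus_exists d P /\ P_minus_nowhere_laplace_degenerate d P].

Definition generic_koenigs_grid (d : nat) P : Prop :=
  koenigs_net P /\ generic_grid d P.

Definition special_touching_conics (d : nat) P C S T : Prop :=
  [/\ touching_conics P C,
      touching_points P C S T,
      forall i, \dim (vjoin T i) = d
    & forall j, \dim (hjoin S j) = d].

Definition inscribed_quadric P C S T Q : Prop :=
  [/\ quadric_in fullv Q,
      forall i j : int, Q `&` points (P i j \v P (i + 1) j \v P i (j + 1)) = C i j,
      forall i, points (vjoin T i) `<=` Q
    & forall j, points (hjoin S j) `<=` Q].

End Nets.

Section Curves.
Variables (R : realType) (n : nat).
Implicit Types (g s t : int -> psubspace R n).

Definition curve g : Prop := forall i, \dim (g i) = 1%N.

(** [osc g m j] is the join of [m] consecutive points, that is, the osculating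
    space C_(m-1)(j). *)
Definition osc g (m : nat) (j : int) : psubspace R n :=
  (\sum_(l < m) g (j + l%:Z)%R)%VS.

(** Here [m = k + 1], for -1 <= k <= n. *)
Definition generic_pair s t : Prop :=
  [/\ curve s, curve t
    & forall (i j : int) (m : nat), (m <= n.+1)%N ->
        \dim (osc s m j \v osc t (n.+1 - m)%N i) = n.+1].

End Curves.

Definition autoconjugate (R : realType) (d : nat) (Q : set (psubspace R (2 * d)))
    (g : int -> psubspace R (2 * d)) : Prop :=
  curve g /\ forall i, points (osc g d i) `<=` Q.

Definition sigma_curve (R : realType) (n d : nat) (S : int -> int -> psubspace R n)
    (j : int) : psubspace R n :=
  (\bigcap_(l < d) hjoin S (j + l%:Z)%R)%VS.

Definition tau_curve (R : realType) (n d : nat) (T : int -> int -> psubspace R n)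
    (i : int) : psubspace R n :=
  (\bigcap_(l < d) vjoin T (i + l%:Z)%R)%VS.

(* Main.v *)
Require Import Defs.
From mathcomp Require Import all_boot all_order all_algebra.
From mathcomp Require Import boolp classical_sets reals.
From mathcomp Require Import zify.

(** Write [W] for the whole space, of linear dimension [2d+1], [H j] and [V i]
    for the spans of the rows and columns of [P], [h j] and [v i] for those of
    the touching points, and [b] for the bilinear form of the quadric.

    Extensivity makes [H j + ... + H (j+r-1)] of linear dimension [d+r], with
    [V i] meeting it exactly in the span of [P i j, ..., P i (j+r-1)].
    Intersecting the spans of consecutive columns amounts to taking Laplace
    transforms, so that nowhere Laplace degeneracy gives
    [(V i :&: ... :&: V (i+r)) :&: (H j + ... + H (j+r-1)) = 0].

    Each touching point is the radical of [b] on its edge while vertices are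
    anisotropic, so [h j] is orthogonal to [H j] and
    [W = h j + v i + P i j].  The form [b] is non-degenerate: if [x] in [H j] is
    in its radical, then [x = a + e] with [a] in [h (j+1)] and [e] in [v i], both
    in the radical; [e] is an isotropic vector of the edge from [P i j] to
    [P i (j+1)], hence in [T i j].  If [e] were non-zero then both faces at that
    edge would carry double lines, so that the Laplace points of these faces
    would both be [T i j], against nowhere Laplace degeneracy.  Hence [x] is in
    [H (j+1)], and so on in all later [H k], [d+2] of which meet in zero.  As the
    radical is the sum of its intersections with [h j] and [v i], it is zero.

    Therefore [h j] is the polar of [H j], intersections of consecutive [h j] are
    polars of sums of [H j], and the osculating spaces of [sigma] are such
    intersections up to [d] points and sums of [h j] beyond.  Genericity of the
    pair is the polar form of the transversality of the [V i] and [H j]. *)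

Set Implicit Arguments.
Unset Strict Implicit.
Unset Printing Implicit Defensive.

Import Order.TTheory GRing.Theory Num.Theory.
(* [all_algebra] also has a [nondegenerate], for sesquilinear forms. *)
Import Defs.

Local Open Scope ring_scope.

Local Notation "U \v W" := (addv U W) (at level 50, left associativity).
Local Notation "U \m W" := (capv U W) (at level 48, left associativity).
Local Notation "U \s W" := (subsetv U W) (at level 70, no associativity).

(** * Spans and intersections of consecutive subspaces *)

Section Dimension.
Variables (K : fieldType) (vT : vectType K).
Implicit Types U V W p q : {vspace vT}.

Lemma addvAC U V W : (U + V + W = U + W + V)%VS.
Proof. by rewrite -!addvA (addvC V). Qed.

Lemma addvCA U V W : (U + (V + W) = V + (U + W))%VS.
Proof. by rewrite !addvA (addvC U). Qed.

Lemma dim1_sub_eq p q : \dim p = 1%N -> \dim q = 1%N -> (p <= q)%VS -> p = q.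
Proof. by move=> p1 q1 pq; apply/eqP; rewrite eqEdim pq p1 q1. Qed.

Lemma dim1_cap0 p U : \dim p = 1%N -> ~~ (p <= U)%VS -> (p :&: U = 0)%VS.
Proof.
move=> p1 pU; apply/eqP; rewrite -dimv_eq0.
have := dimvS (capvSl p U); rewrite p1 leq_eqVlt ltnS leqn0 => /orP[/eqP E|//].
case/negP: pU; suff <- : (p :&: U = p)%VS by exact: capvSr.
by apply: dim1_sub_eq; rewrite ?capvSl.
Qed.

Lemma dim1_mem p v : \dim p = 1%N -> v \in p -> v != 0 -> p = <[v]>%VS.
Proof.
by move=> p1 vp v0; apply/esym/dim1_sub_eq; rewrite ?dim_vline ?v0 ?p1 -?memvE.
Qed.

Lemma dim_add1_le U p : \dim p = 1%N -> (\dim (U + p) <= (\dim U).+1)%N.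
Proof. by move=> p1; have := dimv_sum_cap U p; rewrite p1; lia. Qed.

Lemma dim_add_le U V : (\dim (U + V) <= \dim U + \dim V)%N.
Proof. by have := dimv_sum_cap U V; lia. Qed.

Lemma cap_eq_of_dim U V W : (W <= U)%VS -> (W <= V)%VS ->
  (\dim U + \dim V <= \dim (U + V) + \dim W)%N -> (U :&: V = W)%VS.
Proof.
move=> WU WV le; apply/esym/eqP; rewrite eqEdim subv_cap WU WV /=.
by have := dimv_sum_cap U V; lia.
Qed.

End Dimension.

Section Consecutive.
Variables (R : realType) (n : nat).
Implicit Types (g a : int -> psubspace R n) (U : psubspace R n).
Local Open Scope nat_scope.

(** Dual to [osc], with value the whole space at [m = 0]. By conversion [sigma_curve d S] is
    [cosc (hjoin S) d] and [tau_curve d T] is [cosc (vjoin T) d]. *)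
Definition cosc g (m : nat) (j : int) : psubspace R n :=
  (\bigcap_(l < m) g (j + l%:Z)%R)%VS.

Lemma osc0 g j : osc g 0 j = 0%VS. Proof. by rewrite /osc big_ord0. Qed.

Lemma oscSr g m j : osc g m.+1 j = (osc g m j + g (j + m%:Z)%R)%VS.
Proof. by rewrite /osc big_ord_recr. Qed.

Lemma oscSl g m j : osc g m.+1 j = (g j + osc g m (j + 1)%R)%VS.
Proof.
rewrite /osc big_ord_recl addr0; congr (_ + _)%VS; apply: eq_bigr => i _.
by rewrite /= /bump add1n intS addrA.
Qed.

Lemma osc1 g j : osc g 1 j = g j. Proof. by rewrite oscSl osc0 addv0. Qed.

Lemma osc2 g j : osc g 2 j = (g j + g (j + 1)%R)%VS.
Proof. by rewrite oscSl osc1. Qed.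

Lemma oscP g m j U :
  reflect (forall l, l < m -> (g (j + l%:Z)%R <= U)%VS) (osc g m j <= U)%VS.
Proof.
apply: (iffP subv_sumP) => [h l lm|h l _]; last exact: h.
exact: (h (Ordinal lm)).
Qed.

Lemma osc_sup g m j l : l < m -> (g (j + l%:Z)%R <= osc g m j)%VS.
Proof. by move=> lm; apply: (oscP _ _ _ _ (subvv _)). Qed.

Lemma coscP g m j U :
  reflect (forall l, l < m -> (U <= g (j + l%:Z)%R)%VS) (U <= cosc g m j)%VS.
Proof.
apply: (iffP subv_bigcapP) => [h l lm|h l _]; last exact: h.
exact: (h (Ordinal lm)).
Qed.

Lemma cosc_inf g m j l : l < m -> (cosc g m j <= g (j + l%:Z)%R)%VS.
Proof. by move=> lm; apply: (coscP _ _ _ _ (subvv _)). Qed.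

Lemma coscSl g m j : cosc g m.+1 j = (g j :&: cosc g m (j + 1)%R)%VS.
Proof.
rewrite /cosc big_ord_recl addr0; congr (_ :&: _)%VS; apply: eq_bigr => i _.
by rewrite /= /bump add1n intS addrA.
Qed.

Lemma coscSr g m j : cosc g m.+1 j = (cosc g m j :&: g (j + m%:Z)%R)%VS.
Proof. by rewrite /cosc big_ord_recr. Qed.

Lemma cosc1 g j : cosc g 1 j = g j.
Proof. by rewrite /cosc big_ord_recl big_ord0 addr0 capvf. Qed.

Lemma cosc_meet g m j :
  cosc g m.+2 j = (cosc g m.+1 j :&: cosc g m.+1 (j + 1)%R)%VS.
Proof.
apply/eqP; rewrite eqEsubv subv_cap; apply/andP; split.
  by rewrite {1}(coscSr g m.+1 j) capvSl (coscSl g m.+1 j) capvSr.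
by rewrite (coscSl g m.+1 j) (coscSl g m j) capvS // capvSl.
Qed.

Lemma osc_join g m j : osc g m.+2 j = (osc g m.+1 j + osc g m.+1 (j + 1)%R)%VS.
Proof.
apply/eqP; rewrite eqEsubv subv_add; apply/andP; split; last first.
  by rewrite {1}(oscSr g m.+1 j) addvSl (oscSl g m.+1 j) addvSr.
by rewrite (oscSl g m.+1 j) (oscSl g m j) addvS // addvSl.
Qed.

Lemma osc_dim_le g m j : (forall i, \dim (g i) = 1) -> \dim (osc g m j) <= m.
Proof.
move=> g1; elim: m => [|m IH]; first by rewrite osc0 dimv0.
rewrite oscSr; apply: leq_trans (dim_add1_le _ (g1 _)) _; lia.
Qed.

(** Each further point raises the dimension by at most one, so a long independent run leaves no room
    for a dependent initial run. *)
Lemma osc_dim_prefix g m m' j : (forall i, \dim (g i) = 1) ->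
  m <= m' -> \dim (osc g m' j) = m' -> \dim (osc g m j) = m.
Proof.
move=> g1 /subnKC <-; move: (m' - m) => k.
elim: k => [|k IH]; first by rewrite addn0.
rewrite addnS oscSr => E; apply: IH; apply/eqP.
rewrite eqn_leq osc_dim_le //=.
have := dim_add1_le (osc g (m + k) j) (g1 (j + (m + k)%:Z)%R); rewrite E; lia.
Qed.

Lemma osc_osc g (a b : nat) j : osc (osc g a.+1) b.+1 j = osc g (a + b).+1 j.
Proof.
elim: b j => [|b IH] j; first by rewrite osc1 addn0.
by rewrite osc_join !IH -osc_join addnS.
Qed.

(** The windows starting at [j, ..., j+d-1] all contain the index [j+d-1]. This gives
    autoconjugacy. *)
Lemma osc_cosc_sub g d j : 0 < d ->
  (osc (cosc g d) d j <= g (j + d.-1%:Z)%R)%VS.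
Proof.
move=> d0; apply/oscP => l ld.
have -> : (j + d.-1%:Z = j + l%:Z + (d.-1 - l)%:Z)%R.
  by rewrite -addrA -PoszD subnKC //; lia.
by apply: cosc_inf; lia.
Qed.

End Consecutive.

(** * Laplace transforms *)

Section Laplace.
Variables (R : realType) (n : nat).
Implicit Types (N : int -> int -> psubspace R n) (g a : int -> psubspace R n).

Lemma nondegenerate_edge N i j : nondegenerate N ->
  \dim (hedge N i j) = 2%N /\ \dim (vedge N i j) = 2%N.
Proof.
case=> -[N1 _] hN vN _.
have pair (p q : psubspace R n) : \dim p = 1%N -> \dim q = 1%N -> p <> q ->
    \dim (p + q) = 2%N.
  move=> p1 q1 pq; rewrite dimv_disjoint_sum ?p1 ?q1 //.
  by apply: dim1_cap0 => //; apply/negP => /(dim1_sub_eq p1 q1).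
by split; apply: pair; rewrite ?N1 //; [apply: hN | apply: vN].
Qed.

Lemma nondegenerate_face N i j : nondegenerate N -> \dim (face N i j) = 3%N.
Proof.
case=> -[_ /(_ i j) fle] _ _ /(_ i j)[//|_ _ _ f3].
apply/eqP; rewrite eqn_leq fle //= -f3; apply: dimvS.
by rewrite addvSl.
Qed.

Lemma face_corner N i j : nondegenerate N ->
  face N i j = N i j \v N (i + 1) j \v N i (j + 1).
Proof.
move=> nN; have [_ _ _ /(_ i j)[//|_ _ f3 _]] := nN.
apply/esym/eqP; rewrite eqEdim f3 nondegenerate_face // andbT /face.
by rewrite addvS // addvSl.
Qed.

(** Two opposite edges span the face, so they meet in [2 + 2 - 3 = 1] dimension. As any three
    vertices are independent, [A] is none of the four vertices and can replace either end of both
    edges. *)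
Lemma laplace_plus_spec N i j (A := laplace_plus N i j) : nondegenerate N ->
  [/\ \dim A = 1%N,
      N i j \v N i (j + 1) = N i j \v A,
      N i j \v N i (j + 1) = A \v N i (j + 1),
      N (i + 1) j \v N (i + 1) (j + 1) = N (i + 1) j \v A &
      N (i + 1) j \v N (i + 1) (j + 1) = A \v N (i + 1) (j + 1)].
Proof.
move=> nN; have [[N1' _] _ _ /(_ i j)[//|f1 f2 f3 f4]] := nN.
have N1 k l : \dim (N k l) = 1%N by exact: N1'.
have [_ e] := nondegenerate_edge i j nN.
have [_ e'] := nondegenerate_edge (i + 1) j nN.
have f := nondegenerate_face i j nN.
have dA : \dim A = 1%N.
  have := dimv_sum_cap (vedge N i j) (vedge N (i + 1) j).
  rewrite e e' (_ : _ \v _ = face N i j) ?f; last first.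
    by rewrite /face /vedge addvA [RHS]addvAC [in RHS](addvAC _ (N (i + 1) j)).
  by rewrite /A /laplace_plus /vedge => -[].
have edge (p q : psubspace R n) : \dim p = 1%N -> \dim (p + q) = 2%N ->
    (A <= p + q)%VS -> ~~ (p <= A)%VS -> (p + q = p + A)%VS.
  move=> p1 pq2 Apq pA; apply/esym/eqP; rewrite eqEdim subv_add addvSl Apq /=.
  by rewrite pq2 dimv_disjoint_sum ?p1 ?dA // dim1_cap0.
have Al : A \s N i j \v N i (j + 1) by exact: capvSl.
have Ar : A \s N (i + 1) j \v N (i + 1) (j + 1) by exact: capvSr.
have lt3 (U V : psubspace R n) : (U <= V)%VS -> \dim V = 2%N ->
    \dim U = 3%N -> False.
  by move=> /dimvS; lia.
split=> //.
- apply: edge => //; apply/negP => /subv_trans/(_ Ar) h.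
  apply: (lt3 _ _ _ e' f4).
  by rewrite -addvA subv_add h subvv.
- rewrite addvC [RHS]addvC; apply: edge; rewrite ?(addvC _ (N i j)) //.
  apply/negP => /subv_trans/(_ Ar) h; apply: (lt3 _ _ _ e' f1).
  by rewrite subv_add h subvv.
- apply: edge => //; apply/negP => /subv_trans/(_ Al) h.
  apply: (lt3 _ _ _ e f3).
  by rewrite addvAC subv_add h subvv.
- rewrite addvC [RHS]addvC; apply: edge; rewrite ?(addvC _ (N (i + 1) j)) //.
  apply/negP => /subv_trans/(_ Al) h; apply: (lt3 _ _ _ e f2).
  by rewrite addvAC subv_add h subvv.
Qed.

(** Exchange along the run: [a l] replaces [g l] while [g (l + 1)] is still present. *)
Lemma osc_chain_last g a m j :
  (forall l, g l \v g (l + 1) = a l \v g (l + 1)) ->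
  osc g m.+1 j = osc a m j \v g (j + m%:Z).
Proof.
move=> ga; elim: m => [|m IH]; first by rewrite osc1 osc0 add0v addr0.
rewrite oscSr IH oscSr -!addvA; congr (_ + _)%VS.
by rewrite intS (addrC 1) addrA ga.
Qed.

Lemma osc_chain_first g a m j :
  (forall l, g l \v g (l + 1) = g l \v a l) ->
  (osc g m.+1 j = g j + osc a m j)%VS.
Proof.
move=> ga; elim: m j => [|m IH] j; first by rewrite osc1 osc0 addv0.
by rewrite oscSl IH oscSl !addvA ga.
Qed.

Lemma osc_chain_dim g a m j : (forall l, \dim (a l) = 1%N) ->
  (forall l, \dim (g l) = 1%N) ->
  (forall l, g l \v g (l + 1) = a l \v g (l + 1)) ->
  \dim (osc g m.+1 j) = m.+1 -> \dim (osc a m j) = m.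
Proof.
move=> a1 g1 ga; rewrite (osc_chain_last m j ga) => E.
have := dim_add1_le (osc a m j) (g1 (j + m%:Z)); rewrite E ltnS => ge.
by apply/eqP; rewrite eqn_leq ge osc_dim_le.
Qed.

(** The run of [a] and the first edge of [g] together span [m+1] dimensions, so they meet in
    [m + 2 - (m + 1) = 1]. A Laplace point is thus recovered from the span of its run. *)
Lemma osc_chain_edge g a m j : (forall l, \dim (a l) = 1%N) ->
  (forall l, \dim (g l) = 1%N) ->
  (forall l, g l \v g (l + 1) = g l \v a l) ->
  (0 < m)%N -> \dim (osc g m.+1 j) = m.+1 ->
  osc a m j \m (g j \v g (j + 1)) = a j.
Proof.
move=> a1 g1 ga m0 E.
have aj : (a j <= osc a m j)%VS by have := @osc_sup _ _ a m j 0 m0; rewrite addr0.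
apply: cap_eq_of_dim => //; first by rewrite ga addvSr.
rewrite ga a1 (addvC (g j)) addvA (addv_idPl aj) (addvC (osc a m j)).
rewrite -(osc_chain_first m j ga) E.
have := osc_dim_le m j a1; have := dim_add1_le (a j) (g1 j); rewrite a1; lia.
Qed.

End Laplace.

(** * Iterated Laplace transforms and intersections of column spans *)

Section LaplaceSequence.
Variables (R : realType) (n d : nat) (P : int -> int -> psubspace R n).
Local Notation N := (fun s => P_plus s P).
Hypothesis P_exists : P_plus_exists d P.
Hypothesis P_laplace : P_plus_nowhere_laplace_degenerate d P.
Hypothesis d_gt0 : (0 < d)%N.
Hypothesis col_dim : forall i j, \dim (osc (P i) d.+1 j) = d.+1.
Hypothesis col_neq : forall i j m, (0 < m <= d.+1)%N ->
  osc (P i) m j <> osc (P (i + 1)) m j.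

Lemma P_plus_dim s i j : (s <= d)%N -> \dim (N s i j) = 1%N.
Proof.
case: s => [|s] sd; first by have [[h _] _ _ _] := P_exists d_gt0; exact: h.
by have [] := laplace_plus_spec i j (P_exists sd).
Qed.

Lemma P_plus_neq s i j : (s <= d)%N -> N s i j <> N s (i + 1) j.
Proof.
rewrite leq_eqVlt => /orP[/eqP -> | sd]; first exact: P_laplace.
by have [_ h _ _] := P_exists sd; exact: h.
Qed.

Lemma osc_P_plus_dim s m i j : (s + m <= d.+1)%N ->
  \dim (osc (N s i) m j) = m.
Proof.
elim: s m i j => [|s IH] m i j sm.
  by apply: osc_dim_prefix sm (col_dim i j) => l; apply: (P_plus_dim (s := 0)).
case: m sm => [|m] sm; first by rewrite osc0 dimv0.
have sd : (s < d)%N by lia.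
apply: (osc_chain_dim (g := N s i)); rewrite ?IH //; last by lia.
- by move=> l; apply: (P_plus_dim (s := s.+1)).
- by move=> l; apply: P_plus_dim; apply: ltnW.
- by move=> l; have [] := laplace_plus_spec i l (P_exists sd).
Qed.

(** Columns [i] and [i+1] of the next transform both have their points on the edges of column [i+1]
    of [N s]. If their spans agreed, intersecting with the first such edge would identify two points
    that [P_plus_neq] separates. *)
Lemma osc_P_plus_neq s m i j : (0 < m)%N -> (s + m <= d.+1)%N ->
  osc (N s i) m j <> osc (N s (i + 1)) m j.
Proof.
move=> m0; case: s => [|s] sm; first by apply: col_neq; rewrite m0.
have sd : (s < d)%N by lia.
have spec l := laplace_plus_spec i l (P_exists sd).
have spec' l := laplace_plus_spec (i + 1) l (P_exists sd).
have E := osc_P_plus_dim (s := s) (m := m.+1) (i + 1) j.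
move=> eq; apply: (P_plus_neq (s := s.+1) (i := i) (j := j)) => //.
rewrite -(@osc_chain_edge _ _ (N s (i + 1)) (N s.+1 i) m j) //; last 1 first.
- by apply: E; lia.
- rewrite eq (@osc_chain_edge _ _ (N s (i + 1)) (N s.+1 (i + 1)) m j) //.
  + by move=> l; have [] := spec' l.
  + by move=> l; apply: P_plus_dim; apply: ltnW.
  + by move=> l; have [] := spec' l.
  + by apply: E; lia.
- by move=> l; have [] := spec l.
- by move=> l; apply: P_plus_dim; apply: ltnW.
- by move=> l; have [] := spec l.
Qed.

(** Both runs contain the [m] Laplace points between them; being distinct and of dimension [m+1],
    they share no more. *)
Lemma osc_P_plus_cap s m i j : (s + m <= d)%N ->
  osc (N s i) m.+1 j \m osc (N s (i + 1)) m.+1 j = osc (N s.+1 i) m j.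
Proof.
move=> sm.
have dm i' : \dim (osc (N s i') m.+1 j) = m.+1 by apply: osc_P_plus_dim; lia.
have dm' : \dim (osc (N s.+1 i) m j) = m by apply: osc_P_plus_dim; lia.
have sub : (osc (N s.+1 i) m j <= osc (N s i) m.+1 j)%VS /\
           osc (N s.+1 i) m j \s osc (N s (i + 1)) m.+1 j.
  case: m {dm dm'} sm => [|m] sm; first by rewrite osc0 !sub0v.
  have sd : (s < d)%N by lia.
  have spec l := laplace_plus_spec i l (P_exists sd).
  split.
    rewrite (@osc_chain_last _ _ (N s i) (N s.+1 i)) ?addvSl // => l.
    by have [] := spec l.
  rewrite (@osc_chain_last _ _ (N s (i + 1)) (N s.+1 i)) ?addvSl // => l.
  by have [] := spec l.
apply: cap_eq_of_dim; rewrite ?dm ?dm'; [by case: sub..|].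
have := dimvS (addvSl (osc (N s i) m.+1 j) (osc (N s (i + 1)) m.+1 j)).
rewrite dm leq_eqVlt => /orP[/eqP E|]; last by lia.
case: (@osc_P_plus_neq s m.+1 i j _ _) => //; first by lia.
have EU : osc (N s i) m.+1 j = (osc (N s i) m.+1 j \v osc (N s (i + 1)) m.+1 j).
  by apply/eqP; rewrite eqEdim addvSl -E dm leqnn.
by apply/esym/eqP; rewrite eqEdim !dm leqnn andbT EU addvSr.
Qed.

(** Each further intersection is one Laplace step, by [cosc_meet] and [osc_P_plus_cap], and shortens
    the run by one point. The case [m = 0] is the vanishing needed later. *)
Lemma cosc_osc s m i j : (s + m <= d.+1)%N ->
  cosc (fun i' => osc (P i') (s + m)%N j) s.+1 i = osc (N s i) m j.
Proof.
elim: s m i => [|s IH] m i sm; first by rewrite cosc1.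
rewrite cosc_meet -(@osc_P_plus_cap s m i j) -?IH; try by lia.
by rewrite addnS.
Qed.

End LaplaceSequence.

(** * Extensive grids *)

Section Bigjoin.
Variables (R : realType) (n : nat).
Implicit Types (F : int -> int -> psubspace R n) (U : psubspace R n).

Lemma hjoin_sup F i j : F i j \s hjoin F j.
Proof. by have [h _] := bigjoinP (fun i => F i j); exact: h. Qed.

Lemma vjoin_sup F i j : F i j \s vjoin F i.
Proof. by have [h _] := bigjoinP (F i); exact: h. Qed.

Lemma hjoin_sub F j U : (forall i, F i j \s U) -> hjoin F j \s U.
Proof. by have [_ h] := bigjoinP (fun i => F i j); exact: h. Qed.

End Bigjoin.

Section Grid.
Variables (R : realType) (n d : nat) (P : int -> int -> psubspace R n).
Hypothesis n_dd : n = (d + d)%N.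
Hypothesis d_gt0 : (0 < d)%N.
Hypothesis P_nondeg : nondegenerate P.
Hypothesis hjoin_dim : forall j, \dim (hjoin P j) = d.+1.
Hypothesis vjoin_dim : forall i, \dim (vjoin P i) = d.+1.
Hypothesis P_span : forall i j,
  osc (fun l => osc (P l) d.+1 j) d.+1 i = fullv.
Hypothesis P_exists : P_plus_exists d P.
Hypothesis P_laplace : P_plus_nowhere_laplace_degenerate d P.
Local Notation row j := (fun l => P l j).
Local Notation H := (hjoin P).
Local Notation V := (vjoin P).

Let P1 i j : \dim (P i j) = 1%N.
Proof. by have [[h _] _ _ _] := P_nondeg; exact: h. Qed.

Let dimW : \dim (fullv : psubspace R n) = (d + d).+1.
Proof. by rewrite dimvf dim_matrix mul1r n_dd. Qed.

Lemma corner_sub i j U : P i j \s U -> P (i + 1) j \s U -> P i (j + 1) \s U ->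
  P (i + 1) (j + 1) \s U.
Proof.
move=> U1 U2 U3; apply: (@subv_trans _ _ (face P i j)).
  by rewrite /face -addvA addvC -!addvA addvSl.
by rewrite face_corner // !subv_add U1 U2 U3.
Qed.

(** The fourth vertex of a face lies in the plane of the other three, so membership spreads from the
    first row and column over the patch. *)
Lemma patch_sub i j a b U : (forall l, (l <= a)%N -> P (i + l%:Z) j \s U) ->
  (forall m, (m <= b)%N -> P i (j + m%:Z) \s U) ->
  forall l m, (l <= a)%N -> (m <= b)%N -> P (i + l%:Z) (j + m%:Z) \s U.
Proof.
move=> Urow Ucol; elim=> [|l IHl] m la mb; first by rewrite addr0; exact: Ucol.
elim: m mb => [|m IHm] mb; first by rewrite addr0; exact: Urow.
rewrite !intS ![1 + _]addrC !addrA; apply: corner_sub.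
- by apply: IHl; lia.
- by rewrite -addrA -[_%:Z + 1]addrC -intS; apply: IHm; lia.
- by rewrite -addrA -[_%:Z + 1]addrC -intS; apply: IHl; lia.
Qed.

Lemma row_col_span i j : osc (row j) d.+1 i \v osc (P i) d.+1 j = fullv.
Proof.
apply/eqP; rewrite eqEsubv subvf -(P_span i j); apply/oscP => l ld.
apply/oscP => m md; apply: (patch_sub (a := d) (b := d)) => // k kd.
  by apply: subv_trans (addvSl _ _); apply: (@osc_sup _ _ (row j)).
by apply: subv_trans (addvSr _ _); apply: osc_sup.
Qed.

(** The row and the column share the corner [P i j], so only [2d+1] points span the [2d+1]
    dimensions and they are independent. The corner is dropped once from the column ([E1]) and once
    from the row ([E2]). *)
Lemma row_col_dim i j :
  \dim (osc (row j) d.+1 i) = d.+1 /\ \dim (osc (P i) d.+1 j) = d.+1.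
Proof.
have E1 : osc (row j) d.+1 i \v osc (P i) d (j + 1) = fullv.
  rewrite -(row_col_span i j) (oscSl (P i)) addvA; congr (_ \v _).
  apply/esym/addv_idPl.
  by have := @osc_sup _ _ (row j) d.+1 i 0 isT; rewrite addr0.
have E2 : osc (row j) d (i + 1) \v osc (P i) d.+1 j = fullv.
  rewrite -(row_col_span i j) (oscSl (row j)) -addvA addvCA; congr (_ \v _).
  apply/esym/addv_idPr.
  by have := @osc_sup _ _ (P i) d.+1 j 0 isT; rewrite addr0.
have row_le m k : (\dim (osc (row j) m k) <= m)%N by apply: osc_dim_le.
have col_le m k : (\dim (osc (P i) m k) <= m)%N by apply: osc_dim_le.
have := dim_add_le (osc (row j) d.+1 i) (osc (P i) d (j + 1)).
have := dim_add_le (osc (row j) d (i + 1)) (osc (P i) d.+1 j).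
rewrite E1 E2 dimW.
have := row_le d (i + 1); have := row_le d.+1 i.
have := col_le d (j + 1); have := col_le d.+1 j; lia.
Qed.

Lemma hjoin_osc i j : H j = osc (row j) d.+1 i.
Proof.
apply/esym/eqP; rewrite eqEdim hjoin_dim (row_col_dim i j).1 leqnn andbT.
by apply/oscP => l _; apply: hjoin_sup.
Qed.

Lemma vjoin_osc i j : V i = osc (P i) d.+1 j.
Proof.
apply/esym/eqP; rewrite eqEdim vjoin_dim (row_col_dim i j).2 leqnn andbT.
by apply/oscP => l _; apply: vjoin_sup.
Qed.

Lemma hjoin_vjoin i j : H j \v V i = fullv.
Proof. by rewrite (hjoin_osc i j) (vjoin_osc i j) row_col_span. Qed.

Lemma hjoin_next i j : H (j + 1) \s H j \v P i (j + 1).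
Proof.
rewrite (hjoin_osc i (j + 1)); apply/oscP => l _.
elim: l => [|l IH]; first by rewrite addr0 addvSr.
rewrite intS (addrC 1) addrA; apply: corner_sub => //;
  by apply: subv_trans (hjoin_sup _ _ _) (addvSl _ _).
Qed.

(** Upper bound: by [hjoin_next] each further row adds at most one dimension. Lower bound: the
    remaining [d+1-r] points of a column complete the sum to the whole space. *)
Lemma osc_hjoin_dim r j : (0 < r <= d.+1)%N -> \dim (osc H r j) = (d + r)%N.
Proof.
case: r => [//|r] /= rd; apply/eqP; rewrite eqn_leq; apply/andP; split.
  elim: r rd => [|r IH] rd; first by rewrite osc1 hjoin_dim addn1.
  apply: (@leq_trans (\dim (osc H r.+1 j)).+1); last by have := IH; lia.
  apply: leq_trans (dim_add1_le _ (P1 0 (j + r.+1%:Z))); apply: dimvS.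
  rewrite oscSr subv_add addvSl /= intS (addrC 1) addrA.
  apply: subv_trans (hjoin_next 0 _) _; apply: addvS => //.
  by apply: (@osc_sup _ _ H r.+1 j r).
have : fullv \s osc H r.+1 j \v osc (P 0) (d - r) (j + r.+1%:Z).
  rewrite -(hjoin_vjoin 0 j) subv_add; apply/andP; split.
    by apply: subv_trans (addvSl _ _); rewrite oscSl addvSl.
  rewrite (vjoin_osc 0 j); apply/oscP => l ld; case: (ltnP l r.+1) => lr.
    apply: subv_trans (addvSl _ _); apply: subv_trans (osc_sup H _ lr).
    exact: hjoin_sup.
  apply: subv_trans (addvSr _ _).
  have -> : (j + l%:Z = j + r.+1%:Z + (l - r.+1)%:Z)%R.
    by rewrite -addrA -PoszD subnKC.
  by apply: osc_sup; lia.
move=> /dimvS; rewrite dimW.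
have := dim_add_le (osc H r.+1 j) (osc (P 0) (d - r) (j + r.+1%:Z)).
have := osc_dim_le (d - r) (j + r.+1%:Z) (P1 0); lia.
Qed.

Lemma vjoin_cap_osc r i j : (r <= d.+1)%N -> V i \m osc H r j = osc (P i) r j.
Proof.
case: r => [|r] rd; first by rewrite !osc0 capv0.
apply: cap_eq_of_dim.
- by apply/oscP => l _; apply: vjoin_sup.
- by apply/oscP => l lr; apply: subv_trans (osc_sup H _ lr); apply: hjoin_sup.
rewrite vjoin_dim osc_hjoin_dim //.
have -> : V i \v osc H r.+1 j = fullv.
  apply/eqP; rewrite eqEsubv subvf -(hjoin_vjoin i j) addvC.
  by apply: addvS => //; rewrite oscSl addvSl.
rewrite dimW (osc_dim_prefix (m' := d.+1) (P1 i)) ?(row_col_dim i j).2 //; lia.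
Qed.

(** Equal spans would put [P (i + 1) j] into the intersection of [V i] and [H j], which is the point
    [P i j]. *)
Lemma col_neq i j m : (0 < m <= d.+1)%N -> osc (P i) m j <> osc (P (i + 1)) m j.
Proof.
case: m => [//|m] _ E; have [_ /(_ i j I I) + _ _] := P_nondeg; apply.
apply/esym/dim1_sub_eq; rewrite ?P1 //.
rewrite -[P i j]osc1 -(vjoin_cap_osc i j (r := 1)) // osc1 subv_cap hjoin_sup.
rewrite andbT; apply: (@subv_trans _ _ (osc (P i) m.+1 j)).
  by rewrite E oscSl addvSl.
by apply/oscP => l _; apply: vjoin_sup.
Qed.

(** By [vjoin_cap_osc] each column span is cut down to a run of [r] points, and [cosc_osc] with
    [m = 0] makes [r+1] such runs meet in zero. *)
Lemma cosc_vjoin_cap r i j : (r <= d.+1)%N -> cosc V r.+1 i \m osc H r j = 0%VS.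
Proof.
move=> rd; apply/eqP; rewrite -subv0.
have := cosc_osc P_exists P_laplace d_gt0 (fun i j => (row_col_dim i j).2)
  col_neq (s := r) (m := 0) i j.
rewrite osc0 addn0 => <- //; apply/coscP => l lr.
rewrite -vjoin_cap_osc //; apply: capvS => //; exact: cosc_inf.
Qed.

End Grid.

(** * Orthogonality *)

Lemma lker_dim_ge (K : fieldType) (aT rT : vectType K) (f : 'Hom(aT, rT)) :
  (dim aT <= \dim (lker f) + dim rT)%N.
Proof.
rewrite -dimvf -(limg_ker_dim f fullv) capfv leq_add2l -(dimvf rT).
exact: dimvS (subvf _).
Qed.

Section Form.
Variables (R : realType) (n : nat) (B : 'M[R]_n.+1).
Implicit Types (U V p : psubspace R n) (u v w : 'rV[R]_n.+1).
Local Notation b := (bform B).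

Lemma bformDl u v w : b (u + v) w = b u w + b v w.
Proof. by rewrite /bform !mulmxDl mxE. Qed.

Lemma bformDr u v w : b w (u + v) = b w u + b w v.
Proof. by rewrite /bform linearD mulmxDr mxE. Qed.

Lemma bformZl (a : R) u v : b (a *: u) v = a * b u v.
Proof. by rewrite /bform -!scalemxAl mxE. Qed.

Lemma bformZr (a : R) u v : b u (a *: v) = a * b u v.
Proof. by rewrite /bform linearZ -scalemxAr mxE. Qed.

(** The polar subspace, encoded as the kernel of pairing with a basis of [U], so that rank-nullity
    gives [orth_dim_ge]. *)
Definition orth U : psubspace R n :=
  lker (linfun (mulmxr (B *m (\matrix_(k < \dim U) (vbasis U)`_k)^T))).

Lemma orthP U v : reflect (forall u, u \in U -> b v u = 0) (v \in orth U).
Proof.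
set M := (\matrix_(k < \dim U) (vbasis U)`_k).
have -> : (v \in orth U) = (v *m B *m M^T == 0).
  by rewrite memv_ker lfunE /= mulmxA.
apply: (iffP eqP) => [vM u uU | vU].
  have -> : u = (\row_k coord (vbasis U) k u) *m M.
    rewrite {1}(coord_vbasis uU) mulmx_sum_row; apply: eq_bigr => k _.
    by rewrite mxE rowK.
  by rewrite /bform trmx_mul mulmxA vM mul0mx mxE.
apply/rowP => k; rewrite [RHS]mxE -(vU (vbasis U)`_k); last first.
  by apply: vbasis_mem; rewrite mem_nth // size_tuple.
by rewrite /bform !mxE; apply: eq_bigr => l _; rewrite !mxE.
Qed.

Lemma orth_dim_ge U : (n.+1 <= \dim (orth U) + \dim U)%N.
Proof.
rewrite /orth; set f := linfun _; have := lker_dim_ge f.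
by rewrite !dim_matrix !mul1r.
Qed.

Lemma orthD U V : orth (U + V)%VS = (orth U :&: orth V)%VS.
Proof.
apply/vspaceP => v; rewrite memv_cap.
apply/orthP/andP => [h | [/orthP hU /orthP hV] _ /memv_addP[x xU [y yV ->]]].
  split; apply/orthP => u uU; apply: h; first exact: subvP (addvSl _ _) _ uU.
  exact: subvP (addvSr _ _) _ uU.
by rewrite bformDr hU ?hV ?addr0.
Qed.

Lemma orth0 : orth 0%VS = fullv.
Proof.
apply/vspaceP => v; rewrite memvf; apply/orthP => u.
by rewrite memv0 => /eqP ->; rewrite -[0](scale0r 0) bformZr mul0r.
Qed.

Lemma orth_osc (g : int -> psubspace R n) m j :
  orth (osc g m j) = cosc (fun i => orth (g i)) m j.
Proof.
elim: m j => [|m IH] j; first by rewrite osc0 orth0 /cosc big_ord0.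
by rewrite oscSl coscSl orthD IH.
Qed.

Section Symmetric.
Hypothesis B_sym : B^T = B.

Lemma bformC u v : b u v = b v u.
Proof.
rewrite /bform; suff <- : (v *m B *m u^T)^T = u *m B *m v^T by rewrite mxE.
by rewrite !trmx_mul trmxK B_sym mulmxA.
Qed.

Lemma sub_orthC U V : (U \s orth V) = (V \s orth U).
Proof.
have sym X Y : X \s orth Y -> Y \s orth X.
  move=> /subvP XY; apply/subvP => y yY; apply/orthP => x /XY/orthP/(_ y yY).
  by rewrite bformC.
by apply/idP/idP; apply: sym.
Qed.

Lemma sub_orth_orth U : U \s orth (orth U).
Proof. by rewrite sub_orthC. Qed.

Lemma isotropic_bform U u v : (forall w, w \in U -> b w w = 0) ->
  u \in U -> v \in U -> b u v = 0.
Proof.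
move=> U0 uU vU; have := U0 _ (memvD uU vU).
rewrite !(bformDl, bformDr) !U0 // add0r addr0 (bformC v u) -mulr2n => /eqP.
by rewrite mulrn_eq0 => /eqP.
Qed.

Section Nondegenerate.
Hypothesis B_nondeg : orth fullv = 0%VS.

(** The lower bound holds for [U] and for a complement; their polars meet in the radical, which is
    zero, so neither can exceed it. *)
Lemma orth_dim U : (\dim (orth U) + \dim U = n.+1)%N.
Proof.
apply/eqP; rewrite eqn_leq orth_dim_ge andbT.
have := orth_dim_ge U^C; have := dimv_compl U.
have := dimv_sum_cap (orth U) (orth U^C).
rewrite -orthD addv_complf B_nondeg dimv0 dimvf dim_matrix mul1r.
have := dimvS (subvf (orth U + orth U^C)).
have := dimvS (subvf U); rewrite !dimvf !dim_matrix !mul1r. lia.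
Qed.

Lemma orthK U : orth (orth U) = U.
Proof.
apply/esym/eqP; rewrite eqEdim sub_orth_orth /=.
have := orth_dim U; have := orth_dim (orth U); lia.
Qed.

Lemma full_of_orth U : orth U = 0%VS -> U = fullv.
Proof. by move=> U0; rewrite -[LHS]orthK U0 orth0. Qed.

End Nondegenerate.
End Symmetric.
End Form.

(** * Polar curves *)

Section PolarCurve.
Variables (R : realType) (n d : nat) (B : 'M[R]_n.+1).
Hypothesis B_sym : B^T = B.
Hypothesis B_nondeg : orth B fullv = 0%VS.
Hypothesis n_dd : n = (d + d)%N.
Hypothesis d_gt0 : (0 < d)%N.
Variables h H : int -> psubspace R n.
Hypothesis hE : forall j, h j = orth B (H j).
Hypothesis osc_dim : forall r j, (0 < r <= d.+1)%N -> \dim (osc H r j) = (d + r)%N.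
Local Notation sigma := (cosc h d).

Lemma cosc_polar m j : cosc h m j = orth B (osc H m j).
Proof. by rewrite orth_osc; apply: eq_bigr => l _. Qed.

Lemma cosc_polar_dim m j : (0 < m <= d.+1)%N -> \dim (cosc h m j) = (d.+1 - m)%N.
Proof.
move=> md; have := orth_dim B_nondeg (osc H m j).
by rewrite -cosc_polar osc_dim //; lia.
Qed.

(** Two neighbouring intersections of [k+2] spaces lie in the [k+1] spaces they share and meet in an
    intersection of [k+3]. By [cosc_polar_dim] their join has the dimension of the shared one. *)
Lemma osc_sigma_lt m j : (m < d)%N -> osc sigma m.+1 j = cosc h (d - m) (j + m%:Z).
Proof.
elim: m j => [|m IH] j md; first by rewrite osc1 addr0 subn0.
rewrite osc_join !IH; try by lia.
have [k dk] : exists k, (d - m)%N = k.+2 by exists (d - m).-2; lia.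
have -> : (d - m.+1)%N = k.+1 by lia.
rewrite intS (addrA j) (addrAC j 1) dk.
set j' : int := j + m%:Z; apply/eqP; rewrite eqEdim subv_add.
have E := cosc_meet h k.+1 j'.
rewrite {1}(coscSl h k.+1 j') capvSr {1}(coscSr h k.+1 (j' + 1)) capvSl /=.
have := dimv_sum_cap (cosc h k.+2 j') (cosc h k.+2 (j' + 1)).
rewrite -E !cosc_polar_dim; try by lia.
move: (\dim _) => D; lia.
Qed.

(** A window of [d] points spans a single [h], the case [d - 1] of [osc_sigma_lt]; longer windows
    are sums of such windows. *)
Lemma osc_sigma_ge m j : osc sigma (d + m) j = osc h m.+1 (j + d.-1%:Z).
Proof.
case: d d_gt0 (osc_sigma_lt (m := d.-1)) => [//|d'] _ /= base.
rewrite addSn -osc_osc /osc; apply: eq_bigr => l _.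
by rewrite -/(osc _ d'.+1 _) base // subSnn cosc1 addrAC.
Qed.

(** The starting index stays existential because the transversality used afterwards holds at all
    indices. *)
Lemma orth_osc_sigma_le m j : (m <= d)%N ->
  exists k, orth B (osc sigma m j) = osc H (d.+1 - m) k.
Proof.
case: m => [_|m md].
  exists 0; rewrite osc0 orth0 subn0; apply/esym/eqP.
  rewrite eqEdim subvf osc_dim ?leqnn //= dimvf dim_matrix mul1r n_dd; lia.
exists (j + m%:Z); rewrite osc_sigma_lt // cosc_polar orthK // subSS //.
Qed.

Lemma orth_osc_sigma_ge m j :
  exists k, orth B (osc sigma (d + m) j) = cosc H m.+1 k.
Proof.
exists (j + d.-1%:Z); rewrite osc_sigma_ge orth_osc; apply: eq_bigr => l _.
by rewrite hE orthK.
Qed.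

End PolarCurve.

Section PolarPair.
Variables (R : realType) (n d : nat) (B : 'M[R]_n.+1).
Hypothesis B_sym : B^T = B.
Hypothesis B_nondeg : orth B fullv = 0%VS.
Hypothesis n_dd : n = (d + d)%N.
Hypothesis d_gt0 : (0 < d)%N.
Variables h H v V : int -> psubspace R n.
Hypothesis hE : forall j, h j = orth B (H j).
Hypothesis vE : forall i, v i = orth B (V i).
Hypothesis H_dim : forall r j, (0 < r <= d.+1)%N -> \dim (osc H r j) = (d + r)%N.
Hypothesis V_dim : forall r j, (0 < r <= d.+1)%N -> \dim (osc V r j) = (d + r)%N.
Hypothesis VH_cap : forall r i j, (r <= d.+1)%N -> cosc V r.+1 i \m osc H r j = 0%VS.

Lemma polar_pair_le m i j : (m <= d)%N ->
  osc (cosc h d) m j \v osc (cosc v d) (n.+1 - m) i = fullv.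
Proof.
move=> md; apply: (full_of_orth B_sym B_nondeg); rewrite orthD.
have [k ->] := orth_osc_sigma_le B_sym B_nondeg n_dd d_gt0 hE H_dim j md.
(* With [r = d+1-m], the polars become a sum of [r] spaces [H] and an intersection of [r+1] spaces
   [V], as in [VH_cap]. *)
have -> : (n.+1 - m = d + (d.+1 - m))%N by lia.
have [l ->] := orth_osc_sigma_ge B_sym B_nondeg n_dd d_gt0 vE V_dim (d.+1 - m) i.
by rewrite capvC VH_cap //; lia.
Qed.

End PolarPair.

(** * Conics *)

Local Open Scope classical_set_scope.

Section Conics.
Variables (R : realType) (n : nat).
Implicit Types (B : 'M[R]_n.+1) (U l p s : psubspace R n) (X : set (psubspace R n)).

Lemma zeros_line B U w : w \in U -> w != 0 -> bform B w w = 0 ->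
  zeros B U <[w]>%VS.
Proof.
move=> wU w0 ww; split; first by split; rewrite ?dim_vline ?w0 -?memvE.
by move=> _ /vlineP[k ->]; rewrite bformZl bformZr ww !mulr0.
Qed.

(** As [u] is isotropic, the value at [v + x *: u] is affine in [x] with slope [2 b(u, v)]. *)
Lemma isotropic_shift B u v : B^T = B -> bform B u u = 0 -> bform B u v != 0 ->
  exists x, bform B (v + x *: u) (v + x *: u) = 0.
Proof.
move=> B_sym uu uv; exists (- (bform B v v / (bform B u v *+ 2))).
rewrite !(bformDl, bformDr, bformZl, bformZr) uu (bformC B_sym v u).
rewrite !mulr0 addr0 -addrA -mulr2n -mulrnAr mulNr -mulrA mulVf ?mulr1 ?subrr //.
by rewrite mulrn_eq0.
Qed.

(* Every line through a singular point of [B] and a zero of [B] consists of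
   zeros, whereas a non-degenerate form has a zero not orthogonal to [p]. *)
Lemma nondegenerate_quadric_not_cone B U p : B^T = B ->
  nondegenerate_quadric_in U (zeros B U) -> zeros B U p ->
  ~ singular_point B U p.
Proof.
move=> B_sym [B' [B'_sym _ XE _ nsing]] Xp [pU sing].
have [[p1 _] iso'] : zeros B' U p by rewrite -XE.
have [u up [v vU uv]] : exists2 u, u \in p & exists2 v, v \in U & bform B' u v <> 0.
  apply: contrapT => no; apply: (nsing p); split=> // u v up vU.
  by apply: contrapT => uv; apply: no; exists u => //; exists v.
have uU : u \in U by case: pU => _ /subvP; apply.
have uv0 : bform B' u v != 0 by apply/eqP.
have [pp _] : zeros B U p by [].
have [x ww] := isotropic_shift B'_sym (iso' u up) uv0.
move: ww; set w := v + x *: u => ww.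
have uw : bform B' u w = bform B' u v.
  by rewrite bformDr bformZr (iso' u up) // mulr0 addr0.
have wU : w \in U by rewrite memvD // memvZ.
clearbody w.
have w0 : w != 0.
  by apply: contraNneq uv0 => w0; rewrite -uw w0 -[0](scale0r 0) bformZr mul0r.
have uuw : bform B' u (u + w) = bform B' u v by rewrite bformDr (iso' u up) // add0r.
have uw0 : u + w != 0.
  by apply: contraNneq uv0 => w1; rewrite -uuw w1 -[0](scale0r 0) bformZr mul0r.
have : zeros B' U <[w]>%VS by exact: zeros_line.
rewrite -XE => -[_ /(_ _ (memv_line w)) bw].
(* The contradiction: [u + w] is a zero of [B] since [u] is orthogonal to [U], whereas [B'] takes
   the value [2 b'(u, w)] there. *)
have : zeros B U <[u + w]>%VS.
  apply: zeros_line => //; first by rewrite memvD.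
  by rewrite !(bformDl, bformDr) bw (bformC B_sym w u) !(sing u) // !addr0.
rewrite XE => -[_ /(_ _ (memv_line _))].
rewrite !(bformDl, bformDr) (iso' u up) // ww addr0 add0r.
rewrite (bformC B'_sym w u) uw -mulr2n.
by move/eqP; rewrite mulrn_eq0 (negPf uv0).
Qed.

(** If some [v] in [l] were not orthogonal to [u] in [s], then [isotropic_shift] would give a zero
    [v + x *: u] on [l]. It lies in [s] by uniqueness, hence so does [v], and [s] is isotropic. *)
Lemma touches_rank1 B U l s : B^T = B -> l \s U -> touches (zeros B U) l s ->
  [/\ \dim s = 1%N, s \s l,
      forall u, u \in l -> bform B u u = 0 -> u \in s &
      forall u v, u \in s -> v \in l -> bform B u v = 0].
Proof.
move=> B_sym lU tch.
have [[_ iso] [s1 sl]] : (zeros B U `&` points l) s by rewrite tch.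
have mem u : u \in l -> bform B u u = 0 -> u \in s.
  move=> ul uu; have [->|u0] := eqVneq u 0; first exact: mem0v.
  have : (zeros B U `&` points l) <[u]>%VS.
    split; first by apply: zeros_line => //; apply: (subvP lU).
    by split; rewrite ?dim_vline ?u0 -?memvE.
  by rewrite tch => /= <-; exact: memv_line.
split=> // u v us vl; apply/eqP; apply: contraT => uv.
have ul : u \in l by exact: (subvP sl).
have [x ww] := isotropic_shift B_sym (iso u us) uv.
have vs : v \in s.
  rewrite -(addrK (x *: u) v).
  by rewrite memvB ?memvZ // mem //; rewrite memvD // memvZ.
by case/eqP: uv; apply: (isotropic_bform B_sym iso).
Qed.

End Conics.

(** * Exchange of rows and columns *)

Section Transposition.
Variables (R : realType) (n : nat).
Implicit Types (P : int -> int -> psubspace R n).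

Definition transpose (A : Type) (F : int -> int -> A) : int -> int -> A :=
  fun i j => F j i.

Lemma face_transpose P i j : face (transpose P) i j = face P j i.
Proof. by rewrite /face /transpose addvAC (addvAC (P j i)) addvAC. Qed.

Lemma nondegenerate_transpose P : nondegenerate P -> nondegenerate (transpose P).
Proof.
case=> -[P1 Pf] Ph Pv Pc; split.
- split=> [i j _|i j _]; first exact: P1.
  by rewrite face_transpose; exact: Pf.
- by move=> i j _ _; apply: Pv.
- by move=> i j _ _; apply: Ph.
- move=> i j _; have [//|f1 f2 f3 f4] := Pc j i.
  rewrite /transpose; split.
  + by rewrite addvC addvA addvAC; exact: f1.
  + by rewrite addvAC; exact: f4.
  + by rewrite addvAC; exact: f3.
  + by rewrite addvAC; exact: f2.
Qed.

End Transposition.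

(** * Special inscribed quadrics *)

(** [laplace_minus] is expressed through [laplace_plus] of the transposed net,
    so that transposition visibly preserves the hypotheses and each statement
    on rows also gives the one on columns. *)
Record special_grid (R : realType) (n d : nat) (P S T : int -> int -> psubspace R n)
    (C : int -> int -> set (psubspace R n)) (B : 'M[R]_n.+1) : Prop := SpecialGrid {
  sg_nondeg : nondegenerate P;
  sg_hdim : forall j, \dim (hjoin P j) = d.+1;
  sg_vdim : forall i, \dim (vjoin P i) = d.+1;
  sg_span : forall i j, osc (fun l => osc (P l) d.+1 j) d.+1 i = fullv;
  sg_plus : P_plus_exists d P;
  sg_plus_neq : P_plus_nowhere_laplace_degenerate d P;
  sg_minus : P_plus_exists d (transpose P);
  sg_minus_neq : P_plus_nowhere_laplace_degenerate d (transpose P);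
  sg_sym : B^T = B;
  sg_zeros : forall i j, C i j = zeros B (face P i j);
  sg_conic : forall i j, inscribed_conic P i j (C i j);
  sg_touch : touching_points P C S T;
  sg_hSdim : forall j, \dim (hjoin S j) = d;
  sg_vTdim : forall i, \dim (vjoin T i) = d;
  sg_hSiso : forall j u, u \in hjoin S j -> bform B u u = 0;
  sg_vTiso : forall i u, u \in vjoin T i -> bform B u u = 0 }.

Lemma special_grid_transpose (R : realType) (n d : nat)
    (P S T : int -> int -> psubspace R n) (C : int -> int -> set (psubspace R n)) B :
  special_grid d P S T C B ->
  special_grid d (transpose P) (transpose T) (transpose S) (transpose C) B.
Proof.
case=> nP hd vd sp Pp Pn Mp Mn Bs Cz Cc Ct hS vT hSi vTi; split=> //.
- exact: nondegenerate_transpose.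
- move=> i j; rewrite -(sp j i); exact: exchange_big.
- by move=> i j; rewrite face_transpose; apply: Cz.
- move=> i j; case: (Cc j i) => [[nd t1 t2 t3 t4]|dl]; [left|right].
    split; [|exact: t3|exact: t4|exact: t1|exact: t2].
    by rewrite face_transpose; exact: nd.
  (* By conversion transposition exchanges [laplace_plus] and [laplace_minus], so only the order of
     the sum changes. *)
  rewrite addvC; exact: dl.
- by move=> i j; have [] := Ct j i.
Qed.

Section SpecialGrid.
Variables (R : realType) (n d : nat) (P S T : int -> int -> psubspace R n).
Variables (C : int -> int -> set (psubspace R n)) (B : 'M[R]_n.+1).
Hypothesis G : special_grid d P S T C B.
Local Notation b := (bform B).
Local Notation H := (hjoin P).
Local Notation h := (hjoin S).
Local Notation v := (vjoin T).
Local Notation Rad := (orth B fullv).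

Let nP := sg_nondeg G.
Let Bs := sg_sym G.

Let P1 i j : \dim (P i j) = 1%N.
Proof. by have [[k _] _ _ _] := nP; exact: k. Qed.

Lemma hedge_face i j : hedge P i j \s face P i j.
Proof. by rewrite face_corner // addvSl. Qed.

Lemma vedge_face i j : vedge P i j \s face P i j.
Proof. by rewrite face_corner // addvAC addvSl. Qed.

Lemma S_rank1 i j :
  [/\ \dim (S i j) = 1%N, S i j \s hedge P i j,
      forall u, u \in hedge P i j -> b u u = 0 -> u \in S i j &
      forall x y, x \in S i j -> y \in hedge P i j -> b x y = 0].
Proof.
have [_ + _ _] := sg_touch G i j; rewrite (sg_zeros G).
exact: touches_rank1 Bs (hedge_face i j).
Qed.

Lemma T_rank1 i j :
  [/\ \dim (T i j) = 1%N, T i j \s vedge P i j,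
      forall u, u \in vedge P i j -> b u u = 0 -> u \in T i j &
      forall x y, x \in T i j -> y \in vedge P i j -> b x y = 0].
Proof.
have [_ _ _] := sg_touch G i j; rewrite (sg_zeros G).
exact: touches_rank1 Bs (vedge_face i j).
Qed.

Lemma singular_double i j p : C i j p -> singular_point B (face P i j) p ->
  C i j = points (laplace_plus P i j \v laplace_minus P i j).
Proof.
move=> Cp sing; case: (sg_conic G i j) => // -[].
rewrite (sg_zeros G) => nd.
case: (@nondegenerate_quadric_not_cone _ _ B _ p Bs nd) => //.
by rewrite -(sg_zeros G).
Qed.

(** An isotropic vertex would be the touching point on both of its edges, hence singular, so the
    conic would be a double line through it. With the two Laplace points that line would contain
    both edges, and so the whole plane. *)
Lemma vertex_anisotropic i j u : u \in P i j -> b u u = 0 -> u = 0.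
Proof.
move=> uP uu; apply/eqP; apply: contraT => u0.
have [S1 _ Smem Srad] := S_rank1 i j; have [T1 _ Tmem Trad] := T_rank1 i j.
have PS : P i j = S i j.
  rewrite (dim1_mem (P1 i j) uP u0); apply/esym/dim1_mem => //; apply: Smem => //.
  exact: subvP (addvSl _ _) _ uP.
have PT : P i j = T i j.
  rewrite (dim1_mem (P1 i j) uP u0); apply/esym/dim1_mem => //; apply: Tmem => //.
  exact: subvP (addvSl _ _) _ uP.
have Pf : P i j \s face P i j by rewrite /face -!addvA addvSl.
have sing : singular_point B (face P i j) (P i j).
  split=> // x y xP; rewrite face_corner //.
  case/memv_addP=> y1 y1h [y2 y2P ->]; rewrite bformDr Srad -?PS //.
  by rewrite add0r Trad -?PT //; exact: subvP (addvSr _ _) _ y2P.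
have CP : C i j (P i j).
  rewrite (sg_zeros G); split=> // x xP.
  by rewrite Srad -?PS //; exact: subvP (addvSl _ _) _ xP.
have dbl := singular_double CP sing; move: CP; rewrite dbl => -[_ Psub].
have [A1 EA _ _ _] := laplace_plus_spec i j nP.
have [A1' EA' _ _ _] := laplace_plus_spec j i (nondegenerate_transpose nP).
have : face P i j \s laplace_plus P i j \v laplace_minus P i j.
  rewrite face_corner // !subv_add Psub /=; apply/andP; split.
    apply: (@subv_trans _ _ (hedge P i j)); first exact: addvSr.
    by rewrite /hedge [X in subsetv X]EA' subv_add Psub addvSr.
  apply: (@subv_trans _ _ (vedge P i j)); first exact: addvSr.
  by rewrite /vedge [X in subsetv X]EA subv_add Psub addvSl.
move=> /dimvS; rewrite nondegenerate_face //.
have := dim_add_le (laplace_plus P i j) (laplace_minus P i j); rewrite A1.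
by have -> : \dim (laplace_minus P i j) = 1%N by []; lia.
Qed.

Lemma T_notin_rad i j : (0 < d)%N -> ~ T i j \s Rad.
Proof.
move=> d_gt0.
have [T1 Tv _ _] := T_rank1 i j => /subvP Trad.
have iso u : u \in T i j -> b u u = 0.
  by move=> /Trad/orthP; apply; rewrite memvf.
(* To be used for [i' = i] and [i' = i - 1], the two faces at the edge: the Laplace point lies on
   the edge and on the double line, so it is the touching point. *)
have eqT i' : vedge P i j \s face P i' j ->
    touches (C i' j) (vedge P i j) (T i j) ->
    laplace_plus P i' j \s vedge P i j -> laplace_plus P i' j = T i j.
  move=> vf tch Asub.
  have [CT _] : (C i' j `&` points (vedge P i j)) (T i j) by rewrite tch.
  have dbl : C i' j = points (laplace_plus P i' j \v laplace_minus P i' j).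
    apply: (singular_double CT); split.
      by move: CT; rewrite (sg_zeros G) => -[].
    by move=> x y /Trad/orthP + _; apply; rewrite memvf.
  have [A1 _ _ _ _] := laplace_plus_spec i' j nP.
  have : (C i' j `&` points (vedge P i j)) (laplace_plus P i' j).
    by split=> //; rewrite dbl; split=> //; exact: addvSl.
  by rewrite tch.
have [_ _ tch' tch] := sg_touch G i j.
have vedgeE : vedge P (i - 1 + 1) j = vedge P i j by rewrite subrK.
have E1 := eqT i (vedge_face i j) tch (capvSl _ _).
have E2 : laplace_plus P (i - 1) j = T i j.
  apply: eqT => //; rewrite -vedgeE; last exact: capvSr.
  by apply: subv_trans (addvSl _ _); rewrite -addvA addvSr.
(* For [d = 1] this is nowhere Laplace degeneracy of [P_1], for larger [d] non-degeneracy of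
   [P_1]. *)
have := P_plus_neq (sg_plus G) (sg_plus_neq G) (s := 1) (i := i - 1) (j := j) d_gt0.
by rewrite subrK /P_plus /= E1 E2.
Qed.

Lemma S_sub_hjoin i j : S i j \s H j.
Proof.
have [_ Sh _ _] := S_rank1 i j; apply: subv_trans Sh _.
by rewrite /hedge subv_add !hjoin_sup.
Qed.

Lemma hS_isotropic j x y : x \in h j -> y \in h j -> b x y = 0.
Proof. exact: (isotropic_bform Bs (@sg_hSiso _ _ _ _ _ _ _ _ G j)). Qed.

Lemma vT_isotropic i x y : x \in v i -> y \in v i -> b x y = 0.
Proof. exact: (isotropic_bform Bs (@sg_vTiso _ _ _ _ _ _ _ _ G i)). Qed.

Lemma hS_sub j : h j \s H j.
Proof. by apply: hjoin_sub => i; exact: S_sub_hjoin. Qed.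

(** The span [h j] is totally isotropic and misses the anisotropic vertex, so the dimensions [d] and
    [1] add up. *)
Lemma hjoin_split i j : H j = h j \v P i j.
Proof.
apply/esym/eqP; rewrite eqEdim subv_add hS_sub hjoin_sup (sg_hdim G) /=.
rewrite dimv_disjoint_sum ?(sg_hSdim G) ?P1 ?addn1 // capvC.
apply: dim1_cap0 => //; apply/negP => /subvP Ph.
have : vpick (P i j) != 0 by rewrite vpick0 -dimv_eq0 P1.
have Pp := memv_pick (P i j).
by rewrite (vertex_anisotropic Pp) ?eqxx //; apply: hS_isotropic; apply: Ph.
Qed.

(** For each [S i' j], split [P i j] along [h j] and [P i' j]: the first part is handled by isotropy
    of [h j], the second by tangency at the edge of [S i' j]. *)
Lemma hS_orth_vertex i j x y : x \in h j -> y \in P i j -> b x y = 0.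
Proof.
move=> xh yP; suff /subvP/(_ _ xh)/orthP : h j \s orth B (P i j) by apply.
apply: hjoin_sub => i'; apply/subvP => s sS; apply/orthP => z zP.
have := subvP (hjoin_sup P i j) _ zP; rewrite (hjoin_split i') => /memv_addP.
case=> a ah [c cP ->]; have [_ _ _ rad] := S_rank1 i' j.
rewrite bformDr (hS_isotropic (subvP (hjoin_sup S i' j) _ sS)) // add0r.
by apply: rad => //; apply: subvP (addvSl _ _) _ cP.
Qed.

Lemma hS_sub_orth j : h j \s orth B (H j).
Proof.
apply/subvP => x xh; apply/orthP => y; rewrite (hjoin_split 0) => /memv_addP.
case=> a ah [c cP ->]; rewrite bformDr (hS_isotropic xh ah) add0r.
exact: hS_orth_vertex cP.
Qed.

End SpecialGrid.

(** * Vanishing of the radical and polarity of the row spans *)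

Section Nondegeneracy.
Variables (R : realType) (n d : nat).
Implicit Types (P S T : int -> int -> psubspace R n) (B : 'M[R]_n.+1).
Implicit Types (C : int -> int -> set (psubspace R n)).
Hypothesis n_dd : n = (d + d)%N.
Hypothesis d_gt0 : (0 < d)%N.

Lemma special_grid_span P S T C B i j : special_grid d P S T C B ->
  hjoin P j \v vjoin P i = fullv.
Proof.
by case=> *; apply: (@hjoin_vjoin _ _ d).
Qed.

(** Write [x = a + c + e] along [h j], [P i j], [v i]. Pairing [x] with [c] leaves [b c c], so
    [c = 0]; then [a] pairs with [v i] as [x] does, and it is orthogonal to [h j] and [P i j]. *)
Lemma rad_split P S T C B i j x : special_grid d P S T C B ->
  x \in orth B fullv ->
  exists a e, [/\ a \in hjoin S j, e \in vjoin T i, a \in orth B fullv,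
                  e \in orth B fullv & x = a + e].
Proof.
move=> G /orthP xR; have Gt := special_grid_transpose G.
have Bs := sg_sym G.
have VE : vjoin P i = vjoin T i \v P i j by exact: (hjoin_split Gt j).
have span z : exists a c e, [/\ a \in hjoin S j, c \in P i j, e \in vjoin T i
                              & z = a + c + e].
  have := memvf z; rewrite -(special_grid_span i j G) => /memv_addP[y + [w + ->]].
  rewrite (hjoin_split G i) VE.
  case/memv_addP=> a ah [c cP ->] /memv_addP[e ev [c' c'P ->]].
  exists a, (c + c'), e; split=> //; first exact: memvD.
  by rewrite (addrC e) !addrA.
have hP y z : y \in hjoin S j -> z \in P i j -> bform B y z = 0.
  exact: (hS_orth_vertex G).
have vP y z : y \in vjoin T i -> z \in P i j -> bform B y z = 0.
  exact: (hS_orth_vertex Gt).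
have [a [c [e [ah cP ev xE]]]] := span x.
have c0 : c = 0.
  apply: (vertex_anisotropic G cP); have := xR c (memvf _).
  by rewrite xE !bformDl (hP a) // (vP e) // add0r addr0.
move: xE; rewrite c0 addr0 => xE.
have aR : a \in orth B fullv.
  apply/orthP => z _; have [a' [c' [e' [a'h c'P e'v ->]]]] := span z.
  rewrite !bformDr (hS_isotropic G ah) // (hP a c') // !add0r.
  have := xR e' (memvf _); rewrite xE bformDl (vT_isotropic G ev e'v).
  by rewrite addr0.
exists a, e; split=> //; have -> : e = x - a by rewrite xE addrAC subrr add0r.
by rewrite memvB //; apply/orthP.
Qed.

Lemma cosc_hjoin_cap P S T C B r i j : special_grid d P S T C B -> (r <= d.+1)%N ->
  cosc (vjoin P) r.+1 i \m osc (hjoin P) r j = 0%VS.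
Proof. by case=> *; apply: (@cosc_vjoin_cap _ _ d). Qed.

Lemma special_osc_hjoin_dim P S T C B r j : special_grid d P S T C B ->
  (0 < r <= d.+1)%N -> \dim (osc (hjoin P) r j) = (d + r)%N.
Proof. by case=> *; apply: (@osc_hjoin_dim _ _ d P). Qed.

Lemma rad_hjoin P S T C B j : special_grid d P S T C B ->
  orth B fullv \m hjoin P j = 0%VS.
Proof.
move=> G; have Gt := special_grid_transpose G.
have step k : orth B fullv \m hjoin P k \s hjoin P (k + 1).
  apply/subvP => x; rewrite memv_cap => /andP[xR xH].
  have [a [e [ah ev aR eR xE]]] := rad_split 0 (k + 1) G xR.
  have eE : e = x - a by rewrite xE addrAC subrr add0r.
  have aH : a \in hjoin P (k + 1) by exact: (subvP (hS_sub G _)).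
  (* The difference [x - a] lies in [H k + H (k+1)] and in [V 0], which meet in the edge between the
     two rows. *)
  have eV : e \in vedge P 0 k.
    rewrite /vedge -osc2 -(@vjoin_cap_osc _ _ d P n_dd) //; try by case: G.
    rewrite memv_cap (subvP (hS_sub Gt 0) _ ev) osc2 eE memvB //.
      exact: subvP (addvSl _ _) _ xH.
    exact: subvP (addvSr _ _) _ aH.
  have [T1 _ Tmem _] := T_rank1 G 0 k.
  have eT : e \in T 0 k by apply: Tmem => //; exact: (sg_vTiso G ev).
  have [e0|e0] := eqVneq e 0; first by rewrite xE e0 addr0.
  case: (@T_notin_rad _ _ _ _ _ _ _ _ G 0 k d_gt0).
  by rewrite (dim1_mem T1 eT e0) -memvE.
have all m : orth B fullv \m hjoin P j \s hjoin P (j + m%:Z).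
  elim: m => [|m IH]; first by rewrite addr0 capvSr.
  rewrite intS (addrC 1) addrA; apply: subv_trans (step _).
  by rewrite subv_cap capvSl.
(* The transposed statement at [r = d+1]: the sum of [d+1] column spans is everything, so [d+2]
   consecutive row spans meet in zero. *)
apply/eqP; rewrite -subv0 -(cosc_hjoin_cap j 0 Gt (leqnn _)).
rewrite subv_cap; apply/andP; split; first by apply/coscP => l _; exact: all.
have -> : osc (hjoin (transpose P)) d.+1 0 = fullv; last exact: subvf.
apply/eqP; rewrite eqEdim subvf (special_osc_hjoin_dim _ Gt) ?leqnn //.
by rewrite dimvf dim_matrix mul1r n_dd addnS leqnn.
Qed.

Lemma rad0 P S T C B : special_grid d P S T C B -> orth B fullv = 0%VS.
Proof.
move=> G; have Gt := special_grid_transpose G.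
apply/eqP; rewrite -subv0; apply/subvP => x xR.
have [a [e [ah ev aR eR ->]]] := rad_split 0 0 G xR.
have /eqP -> : a == 0.
  by rewrite -memv0 -(rad_hjoin 0 G) memv_cap aR (subvP (hS_sub G 0)).
have /eqP -> : e == 0.
  by rewrite -memv0 -(rad_hjoin 0 Gt) memv_cap eR (subvP (hS_sub Gt 0)).
by rewrite addr0 mem0v.
Qed.

(** One inclusion is [hS_sub_orth]; equality follows from [d + (d + 1) = n + 1]. *)
Lemma hS_polar P S T C B j : special_grid d P S T C B ->
  hjoin S j = orth B (hjoin P j).
Proof.
move=> G; apply/eqP; rewrite eqEdim (hS_sub_orth G) (sg_hSdim G).
have := orth_dim (rad0 G) (hjoin P j); rewrite (sg_hdim G).
by move: (\dim _) => D; lia.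
Qed.

Lemma sigma_curve_dim P S T C B j : special_grid d P S T C B ->
  \dim (cosc (hjoin S) d j) = 1%N.
Proof.
move=> G; rewrite (cosc_polar_dim (rad0 G) n_dd d_gt0 (H := hjoin P)).
- by rewrite subSnn.
- by move=> k; exact: hS_polar G.
- by move=> r k; exact: special_osc_hjoin_dim G.
- by rewrite d_gt0 leqnSn.
Qed.

Lemma special_pair_le P S T C B m i j : special_grid d P S T C B -> (m <= d)%N ->
  osc (cosc (hjoin S) d) m j \v osc (cosc (vjoin T) d) (n.+1 - m) i = fullv.
Proof.
move=> G md; have Gt := special_grid_transpose G.
apply: (@polar_pair_le _ _ d B (sg_sym G) (rad0 G) n_dd d_gt0
  _ (hjoin P) _ (vjoin P)) => //.
- by move=> k; exact: hS_polar G.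
- by move=> k; exact: (hS_polar _ Gt).
- by move=> r k; exact: special_osc_hjoin_dim G.
- by move=> r k; exact: (special_osc_hjoin_dim _ Gt).
- by move=> r k l; exact: cosc_hjoin_cap G.
Qed.

End Nondegeneracy.

(** * From the definitions to [special_grid], and the final assembly *)

Lemma P_minus_transpose (R : realType) (n : nat) (P : int -> int -> psubspace R n) m :
  P_minus m P = transpose (P_plus m (transpose P)).
Proof. by elim: m => //= m; rewrite /P_minus /P_plus /= => ->. Qed.

Lemma zeros_cap (R : realType) (n : nat) (B : 'M[R]_n.+1) (U : psubspace R n) :
  zeros B fullv `&` points U = zeros B U.
Proof.
apply/seteqP; split=> p /=; first by move=> [[_ iso] pU].
by move=> [[p1 pU] iso]; do !split=> //; exact: subvf.
Qed.

Theorem theorem10p6 (R : realType) (d : nat) (hd : (1 <= d)%N)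
  (P : int -> int -> psubspace R (2 * d))
  (hP : generic_koenigs_grid d P)
  (C : int -> int -> set (psubspace R (2 * d)))
  (S T : int -> int -> psubspace R (2 * d))
  (hC : special_touching_conics d P C S T)
  (Q : set (psubspace R (2 * d)))
  (hQ : inscribed_quadric P C S T Q) :
  let sigma := sigma_curve d S in
  let tau := tau_curve d T in
  [/\ curve sigma, curve tau, generic_pair sigma tau,
      autoconjugate Q sigma & autoconjugate Q tau].
Proof.
move=> sigma tau.
have n_dd : (2 * d = d + d)%N by rewrite mul2n addnn.
case: hQ => -[B [Bs _ QE]] QC QT QS.
have [[nP _] [[_ hd' vd'] ext [Pp Pn] [Mp Mn]]] := hP.
have [[con _] tch vT hS] := hC.
(* The zero vector is treated apart, since it spans no point of [Q]. *)
have iso U : points U `<=` Q -> forall u, u \in U -> bform B u u = 0.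
  move=> UQ u uU; have [->|u0] := eqVneq u 0.
    by rewrite -[0](scale0r 0) bformZl mul0r.
  have : Q <[u]>%VS by apply: UQ; split; rewrite ?dim_vline ?u0 -?memvE.
  by rewrite QE => -[_]; apply; exact: memv_line.
have G : special_grid d P S T C B.
  split=> //.
  - move=> i j; have [_ E] := ext i j; apply/eqP.
    rewrite eqEdim subvf dimvf dim_matrix mul1r /=.
    by apply: leq_trans (eq_leq (esym E)); rewrite n_dd.
  - by move=> k kd; have := Mp k kd; rewrite P_minus_transpose => /nondegenerate_transpose.
  - move=> i j; have := Mn j i; rewrite P_minus_transpose; exact.
  - by move=> i j; rewrite -QC QE zeros_cap -face_corner.
  - by move=> j; apply: iso.
  - by move=> i; apply: iso.
have Gt := special_grid_transpose G.
have c1 : curve sigma by move=> j; exact: (sigma_curve_dim n_dd hd j G).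
have c2 : curve tau by move=> i; exact: (sigma_curve_dim n_dd hd i Gt).
split=> //.
- split=> // i j m mn.
  have -> : osc sigma m j \v osc tau ((2 * d).+1 - m) i = fullv.
    (* For [m > d] the complementary length is at most [d], so the transposed grid applies with the
       two curves exchanged. *)
    have [md|md] := leqP m d; first exact: (special_pair_le n_dd hd i j G md).
    have md' : ((2 * d).+1 - m <= d)%N by lia.
    have := special_pair_le n_dd hd j i Gt md'.
    by rewrite subKn // addvC.
  by rewrite dimvf dim_matrix mul1r.
(* All [d] points lie in the row span [h (j+d-1)], which is contained in [Q]. *)
- split=> // j p [p1 ps]; apply: (QS (j + d.-1%:Z)); split=> //.
  apply: subv_trans ps _; exact: osc_cosc_sub.
- split=> // i p [p1 ps]; apply: (QT (i + d.-1%:Z)); split=> //.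
  apply: subv_trans ps _; exact: osc_cosc_sub.
Qed.
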